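(* Let $G$ be an ample groupoid and let $R$ be a kind, unital $*$-subring of $\mathbb{C}$. If $p\in A_R(G)$ is a projection, i.e. $p=p*p=p^*$, then $p\in D_R(G)$.
   Context: A groupoid $G$ is a small category with all morphisms invertible; its unit space is $G^{(0)}=\{x^{-1}x\mid x\in G\}$, source $s(x)=x^{-1}x$, range $r(x)=xx^{-1}$, and $(x,y)$ is composable iff $s(x)=r(y)$; $G_u=s^{-1}(u)$. A topological groupoid has continuous multiplication and inversion. An ample groupoid is a topological groupoid $G$ (not necessarily Hausdorff) such that $s$ is a local homeomorphism and $G^{(0)}$ is locally compact, totally disconnected and Hausdorff. A compact open bisection is a compact open $B\subseteq G$ on which $s$ and $r$ are injective; $\operatorname{Bis}_c(G)$ is the set of these, and $\operatorname{Bis}_c(G^{(0)})$ is the set of compact open subsets of $G^{(0)}$. A unital $*$-subring of $\mathbb{C}$ is a subring $R\subseteq\mathbb{C}$ containing $1$ and closed under complex conjugation. It is called kind if for all $\lambda_0,\dots,\lambda_n\in R$, $\lambda_0=|\lambda_0|^2+\sum_{i=1}^n|\lambda_i|^2$ implies $\lambda_1=\dots=\lambda_n=0$. Steinberg algebra: $A_R(G)$ is the $R$-submodule of $R^G$ (functions $G\to R$) spanned by the characteristic functions $\mathbf{1}_B$, $B\in\operatorname{Bis}_c(G)$, with convolution product $f*g(x)=\sum_{y\in G_{s(x)}}f(xy^{-1})g(y)$ and involution $f^*(x)=\overline{f(x^{-1})}$. The diagonal subalgebra $D_R(G)$ is the subalgebra generated by $\{\mathbf{1}_U\mid U\in\operatorname{Bis}_c(G^{(0)})\}$.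 *)

(* Defs.v *)
From HB Require Import structures.
From mathcomp Require Import all_boot all_order all_algebra.
From mathcomp Require Import complex.
From mathcomp Require Import all_classical all_reals all_analysis.
Set Implicit Arguments.
Unset Strict Implicit.
Unset Printing Implicit Defensive.
Import Order.TTheory GRing.Theory Num.Theory.
Local Open Scope classical_set_scope.
Local Open Scope ring_scope.

(* A groupoid as an arrows-only category with inverses: objects are identified
   with their identity arrows. [gmul] is a total function whose value on pairs
   that are not composable is unconstrained; [(x, y)] is composable iff
   [gsrc x = grng y]. *)
HB.mixin Record isGroupoid G := {
  gsrc : G -> G;
  grng : G -> G;
  gmul : G -> G -> G;
  ginv : G -> G;
  gsrc_src : forall x, gsrc (gsrc x) = gsrc x;
  grng_src : forall x, grng (gsrc x) = gsrc x;
  gsrc_rng : forall x, gsrc (grng x) = grng x;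
  grng_rng : forall x, grng (grng x) = grng x;
  gsrcM : forall x y, gsrc x = grng y -> gsrc (gmul x y) = gsrc y;
  grngM : forall x y, gsrc x = grng y -> grng (gmul x y) = grng x;
  gmulA : forall x y z, gsrc x = grng y -> gsrc y = grng z ->
    gmul x (gmul y z) = gmul (gmul x y) z;
  gmul_rng : forall x, gmul (grng x) x = x;
  gmul_src : forall x, gmul x (gsrc x) = x;
  gsrcV : forall x, gsrc (ginv x) = grng x;
  grngV : forall x, grng (ginv x) = gsrc x;
  gmulV : forall x, gmul (ginv x) x = gsrc x;
  gmulxV : forall x, gmul x (ginv x) = grng x
}.

#[short(type="groupoidType")]
HB.structure Definition Groupoid := {G of isGroupoid G}.

HB.mixin Record Groupoid_isTopological G & Groupoid G & Topological G := {
  gmul_continuous :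
    {within [set p : G * G | gsrc p.1 = grng p.2],
      continuous (fun p : G * G => gmul p.1 p.2)};
  ginv_continuous : continuous (ginv : G -> G)
}.

#[short(type="topologicalGroupoidType")]
HB.structure Definition TopologicalGroupoid :=
  {G of Groupoid G & Topological G & Groupoid_isTopological G}.

Definition unit_space (G : groupoidType) : set G :=
  [set gmul (ginv x) x | x in [set: G]].
Arguments unit_space : clear implicits.

Lemma gsrc_unit_space (G : groupoidType) (x : G) : gsrc x \in unit_space G.
Proof. by apply/mem_set; exists x => //; exact: gmulV. Qed.

(* The source map with the unit space, as a type, for codomain; the library
   gives [set_type A] the topology induced by the inclusion. *)
Definition source (G : groupoidType) (x : G) : set_type (unit_space G) :=
  SigSub (gsrc_unit_space x).

(* [g] is the inverse of the restriction of [f] to [V]; its values outside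
   [f @` V] are irrelevant. *)
Definition local_homeomorphism (T U : topologicalType) (f : T -> U) : Prop :=
  forall x : T, exists V : set T,
    [/\ open V, V x, open (f @` V) &
      exists g : U -> T,
        [/\ {in V, cancel f g}, {within V, continuous f} &
            {within f @` V, continuous g}]].

HB.mixin Record TopologicalGroupoid_isAmple G & TopologicalGroupoid G := {
  source_local_homeomorphism : local_homeomorphism (@source G);
  unit_space_locally_compact : locally_compact [set: set_type (unit_space G)];
  unit_space_totally_disconnected :
    totally_disconnected [set: set_type (unit_space G)];
  unit_space_hausdorff : hausdorff_space (set_type (unit_space G))
}.

#[short(type="ampleGroupoidType")]
HB.structure Definition AmpleGroupoid :=
  {G of TopologicalGroupoid G & TopologicalGroupoid_isAmple G}.

(* [compact] means quasi-compact: no separation is required of [B]. *)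
Definition compact_open_bisection (G : topologicalGroupoidType) : set (set G) :=
  [set B | [/\ compact B, open B,
               {in B &, injective (gsrc : G -> G)} &
               {in B &, injective (grng : G -> G)}]].

Definition compact_open_unit_set (G : topologicalGroupoidType) :
    set (set G) :=
  [set set_val @` U | U in
    [set U : set (set_type (unit_space G)) | compact U /\ open U]].
Arguments compact_open_unit_set : clear implicits.

Definition unital_star_subring (K : realType) (R : {pred K[i]}) : Prop :=
  GRing.subring_closed R /\ {in R, forall z, z^* \in R}.

Definition kind (K : realType) (R : {pred K[i]}) : Prop :=
  forall (l0 : K[i]) (n : nat) (l : 'I_n -> K[i]),
    l0 \in R -> (forall i, l i \in R) ->
    l0 = `|l0| ^+ 2 + \sum_(i < n) `|l i| ^+ 2 ->
    forall i, l i = 0.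

(* [R]-valued functions on [G] are represented as functions into the complex
   numbers; elements of [steinberg_algebra R G] take values in [R]. *)
Definition steinberg_algebra (K : realType) (R : {pred K[i]})
    (G : ampleGroupoidType) : set (G -> K[i]) :=
  [set f | exists (n : nat) (c : 'I_n -> K[i]) (B : 'I_n -> set G),
    [/\ forall i, c i \in R,
        forall i, compact_open_bisection (B i) &
        f = fun x => \sum_(i < n) c i * \1_(B i) x]].
Arguments steinberg_algebra {K} R G.

(* The sum has finite support when [f] and [g] lie in a Steinberg algebra. *)
Definition convolution (K : realType) (G : ampleGroupoidType)
    (f g : G -> K[i]) : G -> K[i] :=
  fun x => \sum_(y \in [set y : G | gsrc y = gsrc x])
    f (gmul x (ginv y)) * g y.

Definition involution (K : realType) (G : ampleGroupoidType)
    (f : G -> K[i]) : G -> K[i] :=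
  fun x => (f (ginv x))^*.

Definition is_subalgebra (K : realType) (R : {pred K[i]})
    (G : ampleGroupoidType) (S : set (G -> K[i])) : Prop :=
  [/\ S `<=` steinberg_algebra R G,
      S (fun=> 0),
      forall f g, S f -> S g -> S (fun x => f x + g x),
      forall c f, c \in R -> S f -> S (fun x => c * f x) &
      forall f g, S f -> S g -> S (convolution f g)].
Arguments is_subalgebra {K} R G.

Definition diagonal_subalgebra (K : realType) (R : {pred K[i]})
    (G : ampleGroupoidType) : set (G -> K[i]) :=
  smallest (is_subalgebra R G)
    [set (\1_U : G -> K[i]) | U in compact_open_unit_set G].
Arguments diagonal_subalgebra {K} R G.

Definition is_projection (K : realType) (G : ampleGroupoidType)
    (p : G -> K[i]) : Prop :=
  p = convolution p p /\ p = involution p.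

(* Main.v *)
(* At a unit [u], the equation [p = p^* * p] reads
   [p u = \sum_(y in G_u) `|p y| ^+ 2], so kindness makes [p] vanish off the
   unit space. Write [p] as the sum of the [c i * \1_(B i)]. When [G] is not
   Hausdorff, [B i] need not meet the unit space in a compact set, so one cannot
   just restrict this sum. Instead, [p] being supported on units, [p u] is the
   sum of [p] over [G_u], and since [B i] meets [G_u] at most once this is the
   sum of the [c i * \1_(s (B i)) u], with each [s (B i)] compact open. *)
Require Import Defs.
From mathcomp Require Import all_boot all_order all_algebra.
From mathcomp Require Import complex.
From mathcomp Require Import all_classical all_reals all_analysis.
Set Implicit Arguments.
Unset Strict Implicit.
Unset Printing Implicit Defensive.
Import Order.TTheory GRing.Theory Num.Theory.
Local Open Scope classical_set_scope.
Local Open Scope ring_scope.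

Lemma local_homeomorphism_continuous (T U : topologicalType) (f : T -> U) :
  local_homeomorphism f -> continuous f.
Proof.
move=> fP x; have [V [Vo Vx _ [g [_ fc _]]]] := fP x.
by move: fc; rewrite continuous_open_subspace// => /(_ x (mem_set Vx)).
Qed.

Lemma local_homeomorphism_open (T U : topologicalType) (f : T -> U)
    (B : set T) :
  local_homeomorphism f -> open B -> open (f @` B).
Proof.
move=> fP Bo; rewrite openE => _ [x Bx <-]; rewrite /interior.
have [V [Vo Vx fVo [g [fK _ gc]]]] := fP x.
have fVx : (f @` V) (f x) by exists x.
move: gc; rewrite continuous_open_subspace// => /(_ (f x) (mem_set fVx)) gc.
have Bgfx : nbhs (g (f x)) B.
  by rewrite fK ?inE//; apply: open_nbhs_nbhs.
have fVn : nbhs (f x) (f @` V) by apply: open_nbhs_nbhs.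
apply: filterS (filterI fVn (gc _ Bgfx)) => _ [[v Vv <-]].
by rewrite /= fK ?inE// => Bv; exists v.
Qed.

Lemma compact_open_unit_set_gsrc (G : ampleGroupoidType) (B : set G) :
  compact B -> open B -> compact_open_unit_set G (gsrc @` B).
Proof.
(* The witness must live in the type of units, so [source] replaces [gsrc]; composing it with
   [set_val] gives [gsrc] back. *)
move=> Bc Bo; exists (@source G @` B).
  split; last exact: local_homeomorphism_open source_local_homeomorphism Bo.
  apply: continuous_compact Bc; apply: continuous_subspaceT.
  exact: local_homeomorphism_continuous source_local_homeomorphism.
by rewrite image_comp.
Qed.

(** Each [B i] meets the fibre over [u] at most once, so a finite list [F] can replace the fibre in
    sums. It contains [u] so that the term at [u] can be split off. *)
Lemma bisections_fibre (G : ampleGroupoidType) (n : nat) (B : 'I_n -> set G)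
    (u : G) :
  (forall i, compact_open_bisection (B i)) -> gsrc u = u ->
  exists F : seq G, [/\ uniq F, u \in F, {in F, forall y, gsrc y = u} &
    forall i y, B i y -> gsrc y = u -> y \in F].
Proof.
move=> Bb uu; pose P i := [set y | B i y /\ gsrc y = u].
(* If [B i] misses the fibre, [xget] returns the default [u], which still lies in the fibre. *)
exists (undup (u :: [seq xget u (P i) | i <- enum 'I_n])); split.
- exact: undup_uniq.
- by rewrite mem_undup mem_head.
- move=> y; rewrite mem_undup inE => /orP[/eqP->//|/mapP[i _ ->]].
  by case: xgetP => [z _ []|].
- move=> i y Biy yu; rewrite mem_undup inE; apply/orP; right.
  apply/mapP; exists i; first by rewrite mem_enum.
  have [Bz zu] := xgetPex u (ex_intro (P i) y (conj Biy yu)).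
  have [_ _ sinj _] := Bb i.
  by apply: sinj; rewrite ?inE// yu zu.
Qed.

(** By injectivity of the source on [B], at most one entry of [F] lies in [B], and one does exactly
    when [u] is a source of [B]. *)
Lemma sum_indic_fibre (K : realType) (G : ampleGroupoidType) (B : set G)
    (u : G) (F : seq G) :
  {in B &, injective (gsrc : G -> G)} -> uniq F ->
  {in F, forall y, gsrc y = u} ->
  (forall y, B y -> gsrc y = u -> y \in F) ->
  \sum_(y <- F) (\1_B y : K[i]) = \1_(gsrc @` B) u.
Proof.
move=> sinj Fu Fs FB; rewrite [RHS]indicE.
have [[y By yu]|nBu] := pselect ((gsrc @` B) u).
  rewrite [in RHS]mem_set; last by exists y.
  rewrite (bigD1_seq y) ?FB//= indicE mem_set// big_seq_cond big1 ?addr0//.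
  move=> z /andP[zF /eqP zy]; rewrite indicE memNset// => Bz; apply: zy.
  by apply: sinj; rewrite ?inE// yu Fs.
rewrite [in RHS]memNset// big_seq big1// => z zF.
by rewrite indicE memNset// => Bz; apply: nBu; exists z; rewrite ?Fs.
Qed.

Lemma steinberg_algebra_in (K : realType) (R : {pred K[i]})
    (G : ampleGroupoidType) (f : G -> K[i]) (x : G) :
  GRing.subring_closed R -> steinberg_algebra R G f -> f x \in R.
Proof.
move=> [R1 RB RM] [n [c [B [cR _ ->]]]].
have R0 : 0 \in R by rewrite -(subrr 1) RB.
have RD a b : a \in R -> b \in R -> a + b \in R.
  by move=> aR bR; rewrite -[b]opprK RB// -sub0r RB.
apply: (big_ind (fun z => z \in R)) => // i _; apply: RM; first exact: cR.
by rewrite indicE; case: (x \in B i).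
Qed.

Lemma projection_unit (K : realType) (G : ampleGroupoidType)
    (p : G -> K[i]) (u : G) (F : seq G) :
  is_projection p -> gsrc u = u -> uniq F ->
  {in F, forall y, gsrc y = u} ->
  (forall y, p y != 0 -> gsrc y = u -> y \in F) ->
  p u = \sum_(y <- F) `|p y| ^+ 2.
Proof.
move=> [pp pst] uu Fu Fs Fp.
rewrite {1}pp /convolution uu -(fsbig_widen [set` F]).
- rewrite -fsbig_seq// big_seq [RHS]big_seq; apply: eq_bigr => y yF.
  (* Since [u] is the range of [ginv y], the product of [u] and [ginv y] is [ginv y];
     self-adjointness then turns [p (ginv y)] into the conjugate of [p y]. *)
  rewrite -{1}(Fs y yF) -grngV gmul_rng normCK mulrC; congr (_ * _).
  by rewrite [in RHS]pst /involution conjCK.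
- by move=> y /= /Fs.
- move=> y [/= yu yF]; have [->|py] := eqVneq (p y) 0; first by rewrite mulr0.
  by case: yF; exact: Fp.
Qed.

Lemma projection_supp (K : realType) (R : {pred K[i]}) (G : ampleGroupoidType)
    (p : G -> K[i]) (x : G) :
  unital_star_subring R -> kind R -> steinberg_algebra R G p ->
  is_projection p -> gsrc x != x -> p x = 0.
Proof.
move=> [hR _] hk pA pP xu; have pR y := steinberg_algebra_in y hR pA.
have [n [c [B [_ Bb pE]]]] := pA.
have [F [Fu uF Fs FB]] := bisections_fibre Bb (gsrc_src x).
have Fp y : p y != 0 -> gsrc y = gsrc x -> y \in F.
  move=> py yx; apply: contraNT py => yF; rewrite pE big1// => i _.
  by rewrite indicE memNset ?mulr0// => /FB/(_ yx); apply/negP.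
have := projection_unit pP (gsrc_src x) Fu Fs Fp.
(* Splitting off the term at the unit [gsrc x] gives the equation in [kind], with [l0] the value of
   [p] there and the [l i] its values on the rest of [F]. *)
rewrite (perm_big _ (perm_to_rem uF)) big_cons (big_nth x) big_mkord => pu.
have {}pu := hk _ _ (fun i => p (nth x (rem (gsrc x) F) i)) (pR _)
  (fun i => pR _) pu.
apply/eqP; apply: contraT => px.
(* If [p x] is nonzero then [x] is in [F]; not being a unit, it survives the removal of [gsrc x], so
   kindness applies to [p x]. *)
have xF : x \in rem (gsrc x) F.
  by rewrite mem_rem_uniq// inE /= eq_sym xu Fp.
have ix : (index x (rem (gsrc x) F) < size (rem (gsrc x) F))%N.
  by rewrite index_mem.
by move: (pu (Ordinal ix)); rewrite /= nth_index// => /eqP; rewrite (negPf px).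
Qed.

Lemma is_subalgebra_sum (K : realType) (R : {pred K[i]})
    (G : ampleGroupoidType) (S : set (G -> K[i])) (n : nat) (c : 'I_n -> K[i])
    (f : 'I_n -> G -> K[i]) :
  is_subalgebra R G S -> (forall i, c i \in R) -> (forall i, S (f i)) ->
  S (fun x => \sum_(i < n) c i * f i x).
Proof.
move=> [_ S0 SD SZ _]; elim: n c f => [|n IHn] c f cR Sf.
  by under eq_fun do rewrite big_ord0.
under eq_fun do rewrite big_ord_recl.
by apply: SD; [exact: SZ|apply: IHn].
Qed.

Theorem proposition5p1 (K : realType) (R : {pred K[i]}) (G : ampleGroupoidType)
    (hR : unital_star_subring R) (hkind : kind R)
    (p : G -> K[i]) (pA : steinberg_algebra R G p) (pP : is_projection p) :
  diagonal_subalgebra R G p.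
Proof.
have p0 x := projection_supp hR hkind pA pP (x := x).
have [n [c [B [cR Bb pE]]]] := pA.
suff -> : p = fun x => \sum_(i < n) c i * \1_(gsrc @` B i) x.
  move=> S [Salg Sgen]; apply: (is_subalgebra_sum Salg cR) => i; apply: Sgen.
  exists (gsrc @` B i) => //.
  by have [? ? _ _] := Bb i; exact: compact_open_unit_set_gsrc.
apply/funext => x; have [xu|xu] := eqVneq (gsrc x) x; last first.
  rewrite p0// big1// => i _; rewrite indicE memNset ?mulr0//.
  by move=> [y _ yx]; move: xu; rewrite -yx gsrc_src eqxx.
have [F [Fu xF Fs FB]] := bisections_fibre Bb xu.
(* The only unit in the fibre over [x] is [x] itself, so all other terms are zero. *)
transitivity (\sum_(y <- F) p y).
  rewrite (bigD1_seq x)//= big_seq_cond big1 ?addr0// => y /andP[yF yx].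
  by apply: p0; rewrite Fs// eq_sym.
rewrite pE exchange_big/=; apply: eq_bigr => i _.
have [_ _ sinj _] := Bb i.
by rewrite -mulr_sumr (sum_indic_fibre _ sinj Fu Fs (FB i)).
Qed.
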